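(* Let $p$ be a fixed natural number and let $\mathcal{M}=(E,\mathcal{F})$ be a matroid with $|E|=m$, with $p$-parametric weights $w(e,\lambda)$ and parameter interval $I\subseteq\mathbb{R}^p$. The graph of the optimal value function $w\colon I\to\mathbb{R}$ of the $p$-parametric matroid problem contains at most $\mathcal{O}(m^{2p})$ many $p$-dimensional polyhedra.
   Context: A matroid $\mathcal{M}=(E,\mathcal{F})$ consists of a finite ground set $E$ and a family $\mathcal{F}\subseteq 2^E$ of independent sets. Each $e\in E$ has a $p$-parametric weight $w(e,\lambda)=a_e+\lambda_1 b_{1,e}+\dots+\lambda_p b_{p,e}$ with $a_e,b_{1,e},\dots,b_{p,e}\in\mathbb{Q}$. The parameter interval is $I=I_1\times\dots\times I_p\subseteq\mathbb{R}^p$, where each $I_i\subseteq\mathbb{R}$ is a real interval. The weight of a basis $B$ at $\lambda$ is $w(B,\lambda)=\sum_{e\in B}w(e,\lambda)$, and $w_B\colon I\to\mathbb{R}$, $\lambda\mapsto w(B,\lambda)$. The optimal value function is $w\colon I\to\mathbb{R}$, $w(\lambda)=\min\{w_B(\lambda): B\text{ a basis of }\mathcal{M}\}$. It is piecewise linear, continuous and concave, so its graph in $\mathbb{R}^{p+1}$ is a union of $p$-dimensional polyhedra joined along faces of smaller dimension. These $p$-dimensional polyhedra are the distinct sets of the form $\{(\lambda,w(\lambda)):\lambda\in I,\ w_B(\lambda)=w(\lambda)\}$, $B$ a basis of $\mathcal{M}$, that have dimension $p$. Constants in the $\mathcal{O}$-notation may depend on $p$. For distinct $e,f\in E$ the separating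 hyperplane is $h(e,f)=\{\lambda\in\mathbb{R}^p: w(e,\lambda)=w(f,\lambda)\}$. Standing assumption: (a) no two separating hyperplanes (for different unordered pairs) are identical; (b) no separating hyperplane is vertical, i.e. none contains a line parallel to the $p$-th coordinate axis. *)

(* Defs.v *)
From HB Require Import structures.
From mathcomp Require Import all_boot all_order all_algebra.
From mathcomp Require Import all_classical all_reals.

Set Implicit Arguments.
Unset Strict Implicit.
Unset Printing Implicit Defensive.

Import Order.TTheory GRing.Theory Num.Theory.

Local Open Scope ring_scope.

Record matroid (E : finType) := Matroid {
  indep : {set {set E}};
  indep0 : finset.set0 \in indep;
  indepS : forall X Y : {set E}, X \subset Y -> Y \in indep -> X \in indep;
  indep_aug : forall X Y : {set E},
    X \in indep -> Y \in indep -> (#|X| < #|Y|)%N ->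
    exists2 e : E, e \in (Y :\: X)%SET & (e |: X)%SET \in indep
}.

Definition basis (E : finType) (M : matroid E) (B : {set E}) : bool :=
  maxset (fun X : {set E} => X \in indep M) B.

Lemma basis_exists (E : finType) (M : matroid E) : exists B, basis M B.
Proof. by have [B maxB _] := maxset_exists (indep0 M); exists B. Qed.

Definition some_basis (E : finType) (M : matroid E) : {set E} :=
  xchoose (basis_exists M).

Section ParametricWeights.
Variables (R : realType) (p : nat) (E : finType).
Variables (a : E -> rat) (b : 'I_p -> E -> rat).
Implicit Types (x : 'rV[R]_p) (e f : E) (B : {set E}).

Definition weight e x : R := ratr (a e) + \sum_(i < p) x 0 i * ratr (b i e).

Definition basis_weight B x : R := \sum_(e in B) weight e x.

(* The default value of the iterated minimum is itself the weight of a basis,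
   so this is the minimum over the nonempty set of bases. *)
Definition optimal_value (M : matroid E) x : R :=
  \big[Num.min/basis_weight (some_basis M) x]_(B | basis M B) basis_weight B x.

Definition separating_hyperplane e f : set 'rV[R]_p :=
  [set x | weight e x = weight f x]%classic.

End ParametricWeights.
Arguments separating_hyperplane R {p E} a b e f.

(* The index j with j.+1 = p is the last coordinate of 'rV[R]_p. *)
Definition vertical (R : realType) (p : nat) (H : set 'rV[R]_p) : Prop :=
  exists2 j : 'I_p, j.+1 = p :> nat &
  exists x : 'rV[R]_p, forall t : R, H (x + t *: delta_mx 0 j).

Definition parameter_box (R : realType) (p : nat) (I : 'I_p -> interval R) :
    set 'rV[R]_p :=
  [set x | forall i : 'I_p, x 0 i \in I i]%classic.

Definition affinely_independent (R : realType) (n k : nat)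
    (v : 'I_k -> 'rV[R]_n) : Prop :=
  forall c : 'I_k -> R, \sum_(i < k) c i = 0 ->
    \sum_(i < k) c i *: v i = 0 -> forall i, c i = 0.

Definition has_dimension (R : realType) (n : nat) (S : set 'rV[R]_n)
    (d : nat) : Prop :=
  (exists2 v : 'I_d.+1 -> 'rV[R]_n,
     forall i, S (v i) & affinely_independent v) /\
  (forall v : 'I_d.+2 -> 'rV[R]_n,
     (forall i, S (v i)) -> ~ affinely_independent v).

Section Polyhedra.
Variables (R : realType) (p : nat) (E : finType) (M : matroid E).
Variables (a : E -> rat) (b : 'I_p -> E -> rat) (I : 'I_p -> interval R).

(* The point (x, w(x)) of R^(p+1) is encoded as a row vector of size p + 1. *)
Definition graph_piece (B : {set E}) : set 'rV[R]_(p + 1) :=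
  [set row_mx x (optimal_value a b M x)%:M | x in
    [set x | parameter_box I x /\
             basis_weight a b B x = optimal_value a b M x]]%classic.

(* A set of sets, so bases inducing the same piece are counted once. *)
Definition graph_polyhedra : set (set 'rV[R]_(p + 1)) :=
  [set P | exists2 B : {set E}, basis M B &
           P = graph_piece B /\ has_dimension P p]%classic.

End Polyhedra.

(* Main.v *)
(* A piece of the graph of dimension [p] lies over a set with [p + 1] affinely
   independent points, hence over a point [x] at which two elements have equal
   weight only if their weight functions coincide.  The order of the weights at
   [x] determines, as for the greedy algorithm, the weight function of every
   basis optimal at [x], and therefore the piece.  An order at [x] is the
   positivity pattern of the [m ^ 2] affine functions [w(f, x) - w(e, x)].  No
   [p + 1] affine functions on [R^p] realize all patterns, so by the
   Sauer-Shelah lemma at most [(m ^ 2 + 1) ^ p] patterns occur. *)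
Require Import Defs.
From HB Require Import structures.
From mathcomp Require Import all_boot all_order all_algebra.
From mathcomp Require Import all_classical all_reals.

Set Implicit Arguments.
Unset Strict Implicit.
Unset Printing Implicit Defensive.

Import Order.TTheory GRing.Theory Num.Theory.

Local Open Scope ring_scope.

(** * Basis exchange, and optimal bases for weights that order the elements alike *)

Section MatroidExchange.
Variables (E : finType) (M : matroid E).
Implicit Types X Y B : {set E}.

Lemma indep_extend X Y : X \in indep M -> Y \in indep M -> (#|X| <= #|Y|)%N ->
  exists Z : {set E},
    [/\ Z \in indep M, X \subset Z, Z \subset (X :|: Y)%SET & #|Z| = #|Y|].
Proof.
move=> + iY; have [k] := ubnP (#|Y| - #|X|).
elim: k X => // k IHk X ltk iX; rewrite leq_eqVlt => /orP[/eqP eqXY|ltXY].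
  by exists X; split=> //; apply: finset.subsetUl.
have [e /finset.setDP[eY eX] iZ] := indep_aug iX iY ltXY.
have cZ : #|(e |: X)%SET| = #|X|.+1 by rewrite cardsU1 eX.
have [||Z [iZ' sZ sZ' cZ']] := IHk _ _ iZ; rewrite ?cZ //.
  by rewrite -ltnS (leq_trans _ ltk) // ltnS ltn_sub2l.
exists Z; split=> //.
  exact: fintype.subset_trans (finset.subsetUr _ _) sZ.
apply: fintype.subset_trans sZ' _; apply/fintype.subsetP=> z.
by rewrite !finset.inE => /orP[/orP[/eqP->|->]|->]; rewrite ?eY ?orbT.
Qed.

Lemma basis_indep B : basis M B -> B \in indep M.
Proof. by case/maxsetP. Qed.

Lemma basis_card_ge B X : basis M B -> X \in indep M -> (#|X| <= #|B|)%N.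
Proof.
move=> /maxsetP[iB maxB] iX; rewrite leqNgt; apply/negP=> lt.
have [e /finset.setDP[_ eB] iZ] := indep_aug iB iX lt.
have /setP/(_ e) := maxB _ iZ (finset.subsetUr _ _).
by rewrite !finset.inE eqxx (negPf eB).
Qed.

Lemma eq_card_basis B B' : basis M B -> basis M B' -> #|B| = #|B'|.
Proof.
by move=> bB bB'; apply/eqP; rewrite eqn_leq !basis_card_ge ?basis_indep.
Qed.

Lemma indep_card_basis B X : basis M B -> X \in indep M -> #|X| = #|B| ->
  basis M X.
Proof.
move=> bB iX cX; apply/maxsetP; split=> // Y iY sXY.
by apply/esym/eqP; rewrite eqEcard sXY cX basis_card_ge.
Qed.

(** Extending [e |: B :&: B'] by elements of [B'] to the size of [B'] gives an independent [Z]
    inside [e |: B'], which misses exactly one [f] of [B']. As [Z] contains [B :&: B'], this [f]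
    lies outside [B]. *)
Lemma basis_exchange B B' e : basis M B -> basis M B' -> e \in (B :\: B')%SET ->
  exists2 f, f \in (B' :\: B)%SET & basis M (e |: B' :\ f)%SET.
Proof.
move=> bB bB' /finset.setDP[eB eB'].
pose X := (e |: B :&: B')%SET.
have sXB : X \subset B.
  by rewrite finset.subUset finset.sub1set eB finset.subsetIl.
have iX : X \in indep M := indepS sXB (basis_indep bB).
have [|Z [iZ sXZ sZ cZ]] := indep_extend iX (basis_indep bB').
  by rewrite -(eq_card_basis bB bB') subset_leq_card.
have eZ : e \in Z by apply: (fintype.subsetP sXZ); rewrite !finset.inE eqxx.
have sZ' : Z \subset (e |: B')%SET.
  apply: fintype.subset_trans sZ _; apply/fintype.subsetP=> z.
  by rewrite !finset.inE => /orP[/orP[->|/andP[_ ->]]|->]; rewrite ?orbT.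
have [f fB' fZ] : exists2 f, f \in B' & f \notin Z.
  apply/fintype.subsetPn; apply/negP=> sBZ.
  have : (e |: B')%SET \subset Z by rewrite finset.subUset finset.sub1set eZ.
  by move=> /subset_leq_card; rewrite cardsU1 eB' cZ ltnn.
have fB : f \notin B.
  apply: contra fZ => fB; apply: (fintype.subsetP sXZ).
  by rewrite !finset.inE fB fB' orbT.
exists f; first by rewrite !finset.inE fB.
suff <- : Z = (e |: B' :\ f)%SET by apply: indep_card_basis bB' iZ cZ.
apply/eqP; rewrite eqEcard; apply/andP; split.
  apply/fintype.subsetP=> z zZ; have := fintype.subsetP sZ' z zZ.
  rewrite !finset.inE => /orP[->//|->].
  by rewrite andbT (memPn fZ) ?orbT.
by rewrite cardsU1 !finset.inE (negPf eB') andbF cZ (cardsD1 f B') fB'.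
Qed.

Definition min_basis (R : numDomainType) (u : E -> R) B : Prop :=
  basis M B /\
  forall B', basis M B' -> \sum_(e in B) u e <= \sum_(e in B') u e.

Lemma sum_exchange (R : numDomainType) (h : E -> R) B e f :
    e \notin B -> f \in B ->
  \sum_(x in (e |: B :\ f)%SET) h x = \sum_(x in B) h x + (h e - h f).
Proof.
move=> eB fB.
rewrite big_setU1 /=; last by rewrite !finset.inE (negPf eB) andbF.
by rewrite (big_setD1 f fB) /= [RHS]addrC addrA subrK.
Qed.

(* Induction on the size of the symmetric difference: if its least element
   [e] lies in [B \ B'], exchanging [e] for some [f] in [B' \ B] cannot
   improve [B'], so [f] is tied with [e]. *)
Lemma min_basis_sum_eq (R : realDomainType) (u v h : E -> R) B B' :
    (forall e f, (u e < u f) = (v e < v f)) ->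
    (forall e f, u e = u f -> h e = h f) ->
  min_basis u B -> min_basis v B' ->
  \sum_(e in B) h e = \sum_(e in B') h e.
Proof.
have [k] := ubnP (#|(B :\: B')%SET| + #|(B' :\: B)%SET|).
elim: k u v B B' => // k IHk u v B B' ltk uv uh mB mB'.
have [/eqP|[e0 e0D]] := set_0Vmem ((B :\: B') :|: (B' :\: B))%SET.
  rewrite finset.setU_eq0 !finset.setD_eq0 => /andP[sB sB'].
  by have -> : B = B' by apply/eqP; rewrite finset.eqEsubset sB.
have [e eD emin] : exists2 e, e \in (B :\: B' :|: (B' :\: B))%SET &
    forall f, f \in (B :\: B' :|: (B' :\: B))%SET -> u e <= u f.
  by have [e] := arg_minP u e0D; exists e.
(* The situation is symmetric in [(u, B)] and [(v, B')]: [u] and [v] induce the same order, hence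
   the same ties and the same least elements. *)
wlog eB : u v B B' ltk uv uh mB mB' {e0 e0D} eD emin / e \in (B :\: B')%SET.
  move=> hw; case/finset.setUP: (eD) => [|eB]; first exact: hw.
  have vu x y : (v x < v y) = (u x < u y) by rewrite uv.
  have tie x y : v x = v y -> u x = u y.
    by move=> vxy; apply: le_anti; rewrite !leNgt !uv vxy ltxx.
  apply/esym/(hw v u); rewrite ?(addnC #|(B' :\: B)%SET|) 1?finset.setUC //.
    by move=> x y /tie/uh.
  by move=> y yD; rewrite leNgt vu -leNgt emin // finset.setUC.
have [[bB minB] [bB' minB']] := (mB, mB').
have [f fB' bB''] := basis_exchange bB bB' eB.
have /finset.setDP[eB1 eB2] := eB; have /finset.setDP[fB1 fB2] := fB'.
have vef : v f <= v e.
  by have := minB' _ bB''; rewrite sum_exchange // lerDl subr_ge0.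
have uef : u e = u f.
  apply: le_anti; rewrite emin ?finset.in_setU ?fB' ?orbT //=.
  by rewrite leNgt uv -leNgt.
have vef' : v e = v f by apply: le_anti; rewrite vef leNgt -uv uef ltxx.
(* The exchanged basis has the same [v]-sum and [h]-sum as [B'], so it is still optimal, and its
   symmetric difference with [B] has lost [e] and [f]. *)
rewrite (IHk u v B (e |: B' :\ f)%SET) //.
- by rewrite sum_exchange // (uh _ _ uef) subrr addr0.
- apply: leq_trans (ltk : _ <= k)%N; rewrite -addnS; apply: leq_add.
    apply: subset_leq_card; apply/fintype.subsetP=> z.
    rewrite !finset.inE !negb_or negb_and => /andP[/andP[_ /orP[|->->//]]].
    by rewrite negbK => /eqP ->; rewrite (negPf fB2).
  apply: proper_card; apply/properP; split; last first.
    exists f; rewrite // !finset.inE eqxx (negPf fB2) /= orbF.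
    by apply: contraNN eB2 => /eqP<-.
  apply/fintype.subsetP=> z; rewrite !finset.inE.
  case/andP=> zB /orP[/eqP ze|/andP[_ ->]]; last by rewrite zB.
  by rewrite ze eB1 in zB.
- split=> // D bD; apply: le_trans (minB' _ bD).
  by rewrite sum_exchange // vef' subrr addr0.
Qed.

End MatroidExchange.

(** * Shattered sets and the Sauer-Shelah bound *)

Definition shattered (T : finType) (F : {set {set T}}) : {set {set T}} :=
  [set S : {set T} | [forall A : {set T}, (A \subset S) ==>
     [exists B : {set T}, (B \in F) && ((B :&: S)%SET == A)]]]%SET.

Lemma shatteredP (T : finType) (F : {set {set T}}) (S : {set T}) :
  reflect (forall A : {set T}, A \subset S ->
             exists2 B : {set T}, B \in F & (B :&: S)%SET = A)
          (S \in shattered F).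
Proof.
rewrite finset.inE; apply: (iffP forallP) => h A.
  by move=> sA; have /implyP/(_ sA)/exists_inP[B BF /eqP] := h A; exists B.
by apply/implyP=> /h[B BF BS]; apply/exists_inP; exists B; rewrite ?BS.
Qed.

(* Pajor's form of the Sauer-Shelah lemma: split [F] according to membership
   of a point [x]; a set shattered by both halves stays shattered by [F] after
   adding [x]. *)
Lemma leq_card_shattered (T : finType) (F : {set {set T}}) :
  (#|F| <= #|shattered F|)%N.
Proof.
have [k] := ubnP #|F|; elim: k F => // k IHk F ltk.
have [->|[A AF]] := set_0Vmem F; first by rewrite cards0.
have [sF|/fintype.subsetPn[B BF]] := boolP (F \subset [set A]%SET).
  rewrite (leq_trans (subset_leq_card sF)) // cards1 card_gt0.
  apply/finset.set0Pn; exists finset.set0; apply/shatteredP=> C.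
  by rewrite finset.subset0 => /eqP->; exists A; rewrite // finset.setI0.
rewrite finset.inE => neBA.
have [x xAB] : exists x, (x \in A) != (x \in B).
  apply/existsP; apply: contraNT neBA; rewrite negb_exists => /forallP eqAB.
  by apply/eqP/setP=> x; have /negPn/eqP := eqAB x.
pose F1 := [set C in F | x \in C]%SET; pose F0 := [set C in F | x \notin C]%SET.
have cF : #|F| = (#|F1| + #|F0|)%N.
  rewrite -(cardsID [set C : {set T} | x \in C]%SET F).
  by congr addn; apply: eq_card => C; rewrite !finset.inE // andbC.
have [F1_gt0 F0_gt0] : (0 < #|F1|)%N /\ (0 < #|F0|)%N.
  rewrite !card_gt0; split; apply/finset.set0Pn; move: xAB.
    case xA: (x \in A); case xB: (x \in B) => // _.
      by exists A; rewrite finset.inE AF.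
    by exists B; rewrite finset.inE BF.
  case xA: (x \in A); case xB: (x \in B) => // _.
    by exists B; rewrite finset.inE BF xB.
  by exists A; rewrite finset.inE AF xA.
have le1 := IHk F1; have le0 := IHk F0.
have {}le1 : (#|F1| <= #|shattered F1|)%N.
  by apply: le1; rewrite -ltnS (leq_trans _ ltk) // ltnS cF -addn1 leq_add2l.
have {}le0 : (#|F0| <= #|shattered F0|)%N.
  by apply: le0; rewrite -ltnS (leq_trans _ ltk) // ltnS cF -add1n leq_add2r.
(* All members of one half agree on [x], whereas the traces on a shattered set containing [x] would
   include some with [x] and some without. *)
have x1 S : S \in shattered F1 -> x \notin S.
  move=> /shatteredP/(_ finset.set0 (finset.sub0set _))[C].
  rewrite finset.inE => /andP[_ xC] /setP/(_ x).
  by rewrite !finset.inE xC /= => ->.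
have x0 S : S \in shattered F0 -> x \notin S.
  move=> /shatteredP/(_ S (fintype.subxx _))[C].
  rewrite finset.inE => /andP[_ xC] /setP/(_ x).
  by rewrite !finset.inE (negPf xC) /= => <-.
pose S10 := (shattered F1 :&: shattered F0)%SET.
pose addx := fun S : {set T} => (x |: S)%SET.
have inj_addx : {in S10 &, injective addx}.
  move=> S S' /finset.setIP[/x1 xS _] /finset.setIP[/x1 xS' _] eqSS'.
  by rewrite -(setU1K xS) -(setU1K xS') -/(addx S) eqSS'.
(* The two shattered families add up to their union plus their intersection [S10]. The latter is
   replaced by its image under [addx], disjoint from the union since its sets contain [x]. *)
rewrite cF (leq_trans (leq_add le1 le0)) // -cardsUI -(card_in_imset inj_addx).
rewrite -cardsUI [X in (_ + #|pred_of_set X|)%N](_ : _ = finset.set0).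
  rewrite cards0 addn0 subset_leq_card //.
  apply/fintype.subsetP=> S; rewrite !finset.in_setU => /orP[/orP[]|].
  - move=> /shatteredP h; apply/shatteredP=> C /h[D].
    by rewrite finset.inE => /andP[DF _] <-; exists D.
  - move=> /shatteredP h; apply/shatteredP=> C /h[D].
    by rewrite finset.inE => /andP[DF _] <-; exists D.
  case/imsetP=> S' /finset.setIP[S1 S0] ->; apply/shatteredP=> C sC.
  have sC' : (C :\ x)%SET \subset S' by rewrite subDset.
  have [xC|xC] := boolP (x \in C).
    have /shatteredP/(_ _ sC')[D] := S1.
    rewrite finset.inE => /andP[DF xD] /setP eqD; exists D => //.
    apply/setP=> z; have := eqD z; rewrite !finset.inE.
    by case: eqVneq => [->|]; rewrite ?xD ?xC.
  have /shatteredP/(_ _ sC')[D] := S0.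
  rewrite finset.inE => /andP[DF xD] /setP eqD; exists D => //.
  apply/setP=> z; have := eqD z; rewrite !finset.inE.
  by case: eqVneq => [->|]; rewrite ?(negPf xD) ?(negPf xC).
apply/setP=> S; rewrite finset.in_set0; apply/negP=> /finset.setIP[SU].
case/imsetP=> S' _ eqS.
have : x \in S by rewrite eqS finset.setU11.
by case/finset.setUP: SU => [/x1|/x0] /negPf->.
Qed.

(** A set of size at most [p] is recovered from a [p]-tuple over [option T]: its enumeration padded
    with [None]. *)
Lemma card_small_sets (T : finType) (p : nat) :
  (#|[set S : {set T} | #|S| <= p]%SET| <= #|T|.+1 ^ p)%N.
Proof.
pose range (f : {ffun 'I_p -> option T}) :=
  [set x | Some x \in codom f]%SET.
rewrite -card_option -[X in (_ ^ X)%N](card_ord p) -card_ffun.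
apply: leq_trans (leq_imset_card range _).
apply/subset_leq_card/fintype.subsetP=> S; rewrite finset.inE => leS.
apply/imsetP; exists [ffun i : 'I_p => onth (enum S) i] => //.
apply/setP=> x; rewrite finset.inE; apply/idP/codomP => [xS|[i]].
  have lt : (index x (enum S) < p)%N.
    by apply: leq_trans leS; rewrite cardE index_mem mem_enum.
  exists (Ordinal lt); rewrite ffunE /= onthE.
  by rewrite (nth_map x) ?index_mem ?mem_enum // nth_index ?mem_enum.
by rewrite ffunE => ei; rewrite -mem_enum; apply/onthP; exists i.
Qed.

Lemma card_bounded_shattering (T : finType) (F : {set {set T}}) (p : nat) :
    (forall S, S \in shattered F -> (#|S| <= p)%N) ->
  (#|F| <= #|T|.+1 ^ p)%N.
Proof.
move=> small; apply: leq_trans (leq_card_shattered F) _.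
apply: leq_trans (card_small_sets T p).
by apply/subset_leq_card/fintype.subsetP=> S /small; rewrite finset.inE.
Qed.

(** * Affine geometry of [R^p]: generic combinations, spans and sign patterns *)

Section AffineFunctions.
Variables (R : realType) (p : nat).

(* Evaluating along the moment curve [t |-> (1, t, ..., t ^ k)] turns each
   row of [g] into a polynomial in [t]; any positive [t] avoiding the finitely
   many roots of the nonzero ones provides the coefficients. *)
Lemma generic_convex_combination (k : nat) (J : finType)
    (g : J -> 'I_k.+1 -> R) :
  exists c : 'I_k.+1 -> R,
    [/\ forall i, 0 < c i, \sum_i c i = 1 &
        forall j, \sum_i c i * g j i = 0 -> forall i, g j i = 0].
Proof.
pose q j := \poly_(i < k.+1) g j (inord i).
pose Q := \prod_(j | q j != 0) q j.
have Q0 : Q != 0 by apply/prodf_neq0.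
(* These are the integers from 1 to [size Q]; a nonzero [Q] has fewer than [size Q] roots, so one of
   them is not a root. *)
pose rs : seq R := [seq n.+1%:R | n <- iota 0 (size Q)].
have uniq_rs : uniq rs.
  by rewrite map_inj_uniq ?iota_uniq // => m n /eqP; rewrite eqr_nat => /eqP[].
have /allPn[t /mapP[n _ tE] rt] : ~~ all (root Q) rs.
  apply/negP=> roots; have := max_poly_roots Q0 roots uniq_rs.
  by rewrite size_map size_iota ltnn.
have t0 : 0 < t by rewrite tE ltr0Sn.
pose s := \sum_(i < k.+1) t ^+ i.
have s0 : 0 < s.
  rewrite /s big_ord_recl expr0 ltr_pwDl // sumr_ge0 // => i _.
  by rewrite exprn_ge0 // ltW.
exists (fun i => t ^+ i / s); split=> [i||j].
- by rewrite divr_gt0 ?exprn_gt0.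
- by rewrite -mulr_suml divff ?gt_eqF.
have -> : \sum_(i < k.+1) t ^+ i / s * g j i = (q j).[t] / s.
  rewrite horner_poly mulr_suml; apply: eq_bigr => i _.
  by rewrite inord_val mulrAC [_ * g j i]mulrC.
move=> /eqP; rewrite mulf_eq0 invr_eq0 (gt_eqF s0) orbF => qt i.
have q0 : q j = 0.
  apply/eqP; apply: contraNT rt => qj.
  by rewrite /root /Q (bigD1 j) //= hornerM (eqP qt) mul0r.
have : (q j)`_i = 0 by rewrite q0 coef0.
by rewrite coef_poly ltn_ord inord_val.
Qed.

(** Homogenization: affine independence makes the square matrix with rows [(1, v i)] invertible, so
    [(1, z)] is a combination of its rows. *)
Lemma affinely_independent_span (v : 'I_p.+1 -> 'rV[R]_p) (z : 'rV[R]_p) :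
  affinely_independent v ->
  exists2 d : 'I_p.+1 -> R, \sum_i d i = 1 & \sum_i d i *: v i = z.
Proof.
move=> vfree; pose V : 'M[R]_(1 + p) := \matrix_i row_mx 1%:M (v i).
have mulV (c : 'rV_(1 + p)) :
    c *m V = row_mx (\sum_i c 0 i)%:M (\sum_i c 0 i *: v i).
  rewrite mulmx_sum_row; under eq_bigr do rewrite rowK scale_row_mx scalemx1.
  apply/rowP=> j; rewrite summxE; case: (split_ordP j) => j' ->.
    rewrite row_mxEl !mxE ord1 mulr1n; apply: eq_bigr => i _.
    by rewrite row_mxEl mxE mulr1n.
  rewrite row_mxEr summxE; apply: eq_bigr => i _.
  by rewrite row_mxEr.
have Vunit : V \in unitmx.
  rewrite -row_free_unit; apply: inj_row_free => c.
  rewrite mulV -[X in _ = X -> _]row_mx0.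
  move=> /eq_row_mx[c1 c2]; apply/rowP=> i; rewrite mxE.
  apply: (vfree (fun i => c 0 i)) => //.
  by have /rowP/(_ 0) := c1; rewrite !mxE mulr1n.
pose d := row_mx 1%:M z *m invmx V.
have := mulV d; rewrite mulmxKV // => /eq_row_mx[/rowP/(_ 0) d1 dz].
by exists (d 0); rewrite ?dz //; move: d1; rewrite !mxE !mulr1n.
Qed.

(* More than [p] affine functions on [R^p] satisfy a relation
   [\sum_q c q * g q = cst] with [c != 0]; the sign patterns
   [g q > 0 <-> c q > 0] and [g q > 0 <-> c q < 0] cannot both occur. *)
Lemma positivity_pattern_shattering (T : finType) (g : T -> 'rV[R]_p -> R)
    (al : T -> R) (be : T -> 'rV[R]_p) (F : {set {set T}}) (S : {set T}) :
    (forall q x, g q x = al q + \sum_(i < p) x 0 i * be q 0 i) ->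
    (forall A, A \in F -> exists x, A = [set q | 0 < g q x]%SET) ->
    S \in shattered F ->
  (#|S| <= p)%N.
Proof.
move=> gE Fpat /shatteredP shat; rewrite leqNgt; apply/negP=> ltpS.
pose A : 'M[R]_(#|S|, p) := \matrix_(k, i) be (enum_val k) 0 i.
have /rowV0Pn[c cker c0] : kermx A != 0.
  rewrite kermx_eq0 -row_leq_rank -ltnNge.
  exact: leq_ltn_trans (rank_leq_col A) ltpS.
have {cker} cA : c *m A = 0 by apply/sub_kermxP.
have [k0 ck0] : exists k, c 0 k != 0.
  apply/existsP; apply: contraNT c0; rewrite negb_exists => /forallP h.
  by apply/eqP/rowP=> k; rewrite mxE; apply/eqP; have /negPn := h k.
have pattern (P : pred 'I_#|S|) :
    exists x, forall k, (0 < g (enum_val k) x) = P k.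
  have [|B BF BS] := shat [set enum_val k | k in P]%SET.
    by apply/fintype.subsetP=> _ /imsetP[k _ ->]; apply: enum_valP.
  have [x Bx] := Fpat B BF; exists x => k.
  have /setP/(_ (enum_val k)) := BS.
  by rewrite Bx !finset.inE enum_valP andbT mem_imset // => k1 k2 /enum_val_inj.
have cst x : \sum_k c 0 k * g (enum_val k) x = \sum_k c 0 k * al (enum_val k).
  under eq_bigr do rewrite gE mulrDr mulr_sumr.
  rewrite big_split /= exchange_big /= [X in _ + X]big1 ?addr0 // => i _.
  have /rowP/(_ i) := cA; rewrite !mxE => cAi.
  transitivity (x 0 i * \sum_k c 0 k * A k i); last by rewrite cAi mulr0.
  by rewrite mulr_sumr; apply: eq_bigr => k _; rewrite mxE mulrCA.
have [x xP] := pattern (fun k => 0 < c 0 k).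
have [y yP] := pattern (fun k => c 0 k < 0).
have x_ge0 k : 0 <= c 0 k * g (enum_val k) x.
  have := xP k; case: (ltrgt0P (c 0 k)) => [ck gk|ck /negbT|-> _].
  - exact: mulr_ge0 (ltW ck) (ltW gk).
  - by rewrite -leNgt => gk; apply: mulr_le0 => //; apply: ltW.
  - by rewrite mul0r.
have y_le0 k : c 0 k * g (enum_val k) y <= 0.
  have := yP k; case: (ltrgt0P (c 0 k)) => [ck /negbT|ck gk|-> _].
  - by rewrite -leNgt => gk; apply: mulr_ge0_le0 => //; apply: ltW.
  - exact: mulr_le0_ge0 (ltW ck) (ltW gk).
  - by rewrite mul0r.
(* Both sums equal the same constant, yet no term at [x] is below the one at [y], and the terms at
   [k0] differ strictly. *)
have : 0 < \sum_k (c 0 k * g (enum_val k) x - c 0 k * g (enum_val k) y).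
  rewrite (bigD1 k0) //= ltr_pwDl //.
    have := xP k0; have := yP k0; have := x_ge0 k0; have := y_le0 k0.
    case: (ltrgt0P (c 0 k0)) ck0 => // ck _ yk xk gy gx.
      by rewrite ltr_wpDr ?oppr_ge0 // mulr_gt0.
    by rewrite ltr_wpDl // oppr_gt0 pmulr_llt0.
  by apply: sumr_ge0 => k _; rewrite subr_ge0 (le_trans (y_le0 k)).
by rewrite sumrB !cst subrr ltxx.
Qed.

End AffineFunctions.

(** * From pieces of the graph to orders of the weights *)

Section WeightFunctions.
Variables (R : realType) (p : nat) (E : finType) (M : matroid E).
Variables (a : E -> rat) (b : 'I_p -> E -> rat).
Implicit Types (x z : 'rV[R]_p) (e f : E) (B : {set E}).

(** The sum of the [c i] is left free: value 1 serves for affine combinations, value 0 for affine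
    dependences. *)
Lemma sum_weight k (c : 'I_k -> R) (v : 'I_k -> 'rV[R]_p) e :
  \sum_i c i * weight a b e (v i) =
  (\sum_i c i) * ratr (a e) + \sum_j (\sum_i c i *: v i) 0 j * ratr (b j e).
Proof.
rewrite /weight; under eq_bigr do rewrite mulrDr mulr_sumr.
rewrite big_split /= mulr_suml exchange_big /=; congr (_ + _).
apply: eq_bigr => j _; rewrite summxE mulr_suml; apply: eq_bigr => i _.
by rewrite mxE mulrA.
Qed.

Lemma weight_affine_comb k (c : 'I_k -> R) (v : 'I_k -> 'rV[R]_p) e :
    \sum_i c i = 1 ->
  weight a b e (\sum_i c i *: v i) = \sum_i c i * weight a b e (v i).
Proof. by move=> c1; rewrite sum_weight c1 mul1r. Qed.

Lemma basis_weight_affine_comb k (c : 'I_k -> R) (v : 'I_k -> 'rV[R]_p) B :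
    \sum_i c i = 1 ->
  basis_weight a b B (\sum_i c i *: v i) =
  \sum_i c i * basis_weight a b B (v i).
Proof.
move=> c1; rewrite /basis_weight; under [RHS]eq_bigr do rewrite mulr_sumr.
by rewrite exchange_big; apply: eq_bigr => e _; apply: weight_affine_comb.
Qed.

Lemma optimal_valueP B x : basis M B ->
  basis_weight a b B x = optimal_value a b M x <->
  min_basis M (fun e => weight a b e x) B.
Proof.
move=> bB; split=> [eqB | [_ minB]].
  by split=> // B' bB'; rewrite -/(basis_weight a b B x) eqB bigmin_le_cond.
apply: le_anti; rewrite bigmin_le_cond // andbT.
apply: le_bigmin => [|B' bB']; last exact: minB.
(* The default of the iterated minimum is the weight of [some_basis M], bounded here separately. *)
exact/minB/xchooseP.
Qed.

Variable I : 'I_p -> interval R.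

(** The point is a generic convex combination of the projections of [p + 1] affinely independent
    points of the piece. [B] is optimal at each projection, hence at the combination. *)
Lemma graph_polyhedra_generic_point P : graph_polyhedra M a b I P ->
  exists B x,
    [/\ P = graph_piece M a b I B, min_basis M (fun e => weight a b e x) B &
        forall e f, weight a b e x = weight a b f x ->
          forall z, weight a b e z = weight a b f z].
Proof.
move=> [B bB [-> [[v vP vfree] _]]].
have /choice[y yP] (i : 'I_p.+1) : exists x : 'rV[R]_p,
    basis_weight a b B x = optimal_value a b M x /\
    v i = row_mx x (optimal_value a b M x)%:M.
  by have [x [_ wx] <-] := vP i; exists x.
(* On the piece the last coordinate is the affine function [basis_weight a b B], so a dependence
   between projections lifts to the graph. *)
have yfree : affinely_independent y.
  move=> c c0 cy; apply: vfree => //.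
  have cB : \sum_i c i * basis_weight a b B (y i) = 0.
    rewrite /basis_weight; under eq_bigr do rewrite mulr_sumr.
    rewrite exchange_big big1 // => e _ /=.
    rewrite sum_weight c0 cy mul0r add0r big1 // => j _.
    by rewrite mxE mul0r.
  transitivity (row_mx (\sum_i c i *: y i)
                 (\sum_i c i * basis_weight a b B (y i))%:M : 'rV[R]_(p + 1)).
    apply/rowP=> j; rewrite summxE; case: (split_ordP j) => j' ->.
      rewrite row_mxEl summxE; apply: eq_bigr => i _.
      by rewrite (yP i).2 mxE row_mxEl mxE.
    rewrite row_mxEr ord1 mxE mulr1n; apply: eq_bigr => i _.
    by rewrite (yP i).2 (yP i).1 mxE row_mxEr mxE mulr1n.
  by rewrite cy cB raddf0 row_mx0.
have [c [c0 c1 cgen]] := generic_convex_combination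
  (fun (q : E * E) i => weight a b q.1 (y i) - weight a b q.2 (y i)).
exists B, (\sum_i c i *: y i); split=> // [|e f].
  split=> // B' bB'.
  rewrite -/(basis_weight a b B _) -/(basis_weight a b B' _).
  rewrite !basis_weight_affine_comb //; apply: ler_sum => i _.
  rewrite ler_pM2l //.
  by have /optimal_valueP-/(_ bB)[_] := (yP i).1; apply.
(* By genericity, a tie at the combination is a tie at every [y i], hence everywhere, as the [y i]
   affinely span the space. *)
rewrite !weight_affine_comb // => /eqP; rewrite -subr_eq0 -sumrB => /eqP ef z.
have [d d1 <-] := affinely_independent_span z yfree.
rewrite !weight_affine_comb //; apply: eq_bigr => i _; congr (_ * _).
apply/eqP; rewrite -subr_eq0; apply/eqP; apply: (cgen (e, f)).
by rewrite -[RHS]ef; apply: eq_bigr => l _; rewrite mulrBr.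
Qed.

Lemma eq_graph_piece B B' :
    (forall z : 'rV[R]_p, basis_weight a b B z = basis_weight a b B' z) ->
  graph_piece M a b I B = graph_piece M a b I B'.
Proof.
move=> eqB; congr (image _ _); apply/funext=> x /=.
by rewrite eqB.
Qed.

(** Phrased as positivity of affine functions to fit [positivity_pattern_shattering]. *)
Definition strict_order x : {set E * E} :=
  [set q | 0 < weight a b q.2 x - weight a b q.1 x]%SET.

Lemma strict_orderP x y : strict_order x = strict_order y ->
  forall e f, (weight a b e x < weight a b f x) =
              (weight a b e y < weight a b f y).
Proof.
by move=> /setP eqxy e f; have := eqxy (e, f); rewrite !finset.inE !subr_gt0.
Qed.

Definition strict_orders : {set {set E * E}} :=
  [set A | `[< exists x, A = strict_order x >]]%SET.

Lemma card_strict_orders : (#|strict_orders| <= (#|E| ^ 2).+1 ^ p)%N.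
Proof.
rewrite -mulnn -card_prod; apply: card_bounded_shattering => S shat.
apply: (positivity_pattern_shattering
  (g := fun q x => weight a b q.2 x - weight a b q.1 x)
  (al := fun q => ratr (a q.2) - ratr (a q.1))
  (be := fun q => \row_i (ratr (b i q.2) - ratr (b i q.1))) _ _ shat).
- move=> q x; rewrite /weight /= opprD addrACA -sumrB; congr (_ + _).
  by apply: eq_bigr => i _; rewrite mxE mulrBr.
- by move=> A; rewrite finset.inE => /asboolP.
Qed.

(** Choosing a generic point for each piece and recording the strict order there is injective on
    pieces. *)
Lemma card_graph_polyhedra :
  (graph_polyhedra M a b I #<= `I_((#|E| ^ 2).+1 ^ p))%card.
Proof.
have /choice[s sP] (P : set 'rV[R]_(p + 1)) : exists A : {set E * E},
    graph_polyhedra M a b I P -> exists B x,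
    [/\ P = graph_piece M a b I B, min_basis M (fun e => weight a b e x) B,
        forall e f, weight a b e x = weight a b f x ->
          forall z, weight a b e z = weight a b f z & A = strict_order x].
  have [/graph_polyhedra_generic_point[B [x [? ? ?]]]|nP] :=
    pselect (graph_polyhedra M a b I P); last by exists finset.set0.
  by exists (strict_order x) => _; exists B, x.
apply: card_le_trans (_ : `I_(#|strict_orders|) #<= _)%card; last first.
  by rewrite card_le_II card_strict_orders.
apply/pcard_leP/injfunPex.
have sF P : graph_polyhedra M a b I P -> s P \in enum strict_orders.
  move=> /sP[B [x [_ _ _ ->]]]; rewrite mem_enum finset.inE.
  by apply/asboolP; exists x.
exists (fun P => index (s P) (enum strict_orders)) => [P /sF|P P'].
  by rewrite -index_mem cardE.
move=> /set_mem PP /set_mem PP'.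
move=> /(congr1 (nth finset.set0 (enum strict_orders))).
rewrite !nth_index ?sF //.
have [B [x [-> mB xgen ->]]] := sP _ PP.
have [B' [x' [-> mB' _ ->]]] := sP _ PP'.
move=> /strict_orderP eqxx'; apply: eq_graph_piece => z.
(* Here [h] is the weight at the arbitrary point [z]: ties at the generic [x] persist at [z], so
   both bases weigh the same there. *)
exact: (min_basis_sum_eq eqxx' (fun e f ef => xgen e f ef z) mB mB').
Qed.

End WeightFunctions.

Theorem corollary3p4 (R : realType) (p : nat) :
  exists C : nat,
  forall (m : nat) (E : finType) (M : matroid E)
    (a : E -> rat) (b : 'I_p -> E -> rat) (I : 'I_p -> interval R),
  (0 < m)%N -> #|E| = m ->
  (forall e f e' f' : E, e != f -> e' != f' ->
     [set e; f]%SET != [set e'; f']%SET ->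
     separating_hyperplane R a b e f <> separating_hyperplane R a b e' f') ->
  (forall e f : E, e != f -> ~ vertical (separating_hyperplane R a b e f)) ->
  (graph_polyhedra M a b I #<= `I_(C * m ^ (2 * p)))%card.
Proof.
(* For positive [m], [m ^ 2 + 1 <= 2 * m ^ 2]; raising this to the power [p] yields the constant. *)
exists (2 ^ p)%N => m E M a b I m_gt0 cE _ _.
apply: card_le_trans (card_graph_polyhedra M a b I) _.
rewrite card_le_II cE expnM -expnMn; have [->//|p_gt0] := posnP p.
by rewrite leq_exp2r // mul2n -addnn -addn1 leq_add2l expn_gt0 m_gt0.
Qed.
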